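(* For every compact measurable space $(X,\mathcal{A})$ there is a compact $T$-measurable space $(Y,\mathcal{A}')$ such that $M(X)\cong M(Y)$ as rings.
   Context: A measurable space $(X,\mathcal{A})$ is a nonempty set $X$ with a $\sigma$-algebra $\mathcal{A}$ of subsets of $X$. $M(X)$ is the commutative ring (pointwise operations) of all functions $f:X\to\mathbb{R}$ with $f^{-1}(V)\in\mathcal{A}$ for every open $V\subseteq\mathbb{R}$; $M(Y)$ is defined likewise from $(Y,\mathcal{A}')$. A measurable space is $T$-measurable if whenever $x,y$ are distinct points of it, there is a measurable set containing one of them and not the other. $(X,\mathcal{A})$ is a compact measurable space if $\mathcal{A}$, ordered by inclusion, is a compact lattice, i.e. its top element $X$ is compact: whenever $X=\bigvee S$ with $S\subseteq\mathcal{A}$, there is a finite $T\subseteq S$ with $X=\bigvee T$. A compact $T$-measurable space is a measurable space that is both compact and $T$-measurable. *)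

(* Defs.v *)
From HB Require Import structures.
From mathcomp Require Import all_boot all_order all_algebra.
From mathcomp Require Import all_classical all_reals all_analysis measurable_realfun.
Set Implicit Arguments.
Unset Strict Implicit.
Unset Printing Implicit Defensive.
Import Order.TTheory GRing.Theory Num.Theory.
Import numFieldNormedType.Exports.
Local Open Scope classical_set_scope.
Local Open Scope ring_scope.

(* Every [measurableType] is pointed, hence nonempty. *)

(* The join is taken in the poset of measurable sets ordered by inclusion: it
   contains the union of S, and may be strictly larger when S is uncountable. *)
Definition is_join d (X : measurableType d) (S : set (set X)) (U : set X) :
  Prop :=
  [/\ measurable U,
      forall A, S A -> A `<=` U &
      forall V, measurable V -> (forall A, S A -> A `<=` V) -> U `<=` V].

Definition compact_measurable_space d (X : measurableType d) : Prop :=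
  forall S : set (set X), S `<=` measurable -> is_join S setT ->
  exists T : set (set X), [/\ T `<=` S, finite_set T & is_join T setT].

Definition T_measurable_space d (X : measurableType d) : Prop :=
  forall x y : X, x <> y ->
  exists A : set X, measurable A /\ ((A x /\ ~ A y) \/ (A y /\ ~ A x)).

(* M(X) is the library's ring {mfun X >-> R} of Borel-measurable functions,
   with pointwise operations; its elements are the functions pulling open sets
   back to measurable sets. *)
Lemma measurable_funT_openP d (X : measurableType d) (R : realType)
    (f : X -> R) :
  measurable_fun setT f <->
  (forall V : set R, open V -> measurable (f @^-1` V)).
Proof.
split=> [mf V oV|fo].
  by rewrite -[_ @^-1` _]setTI; apply: mf => //; exact: open_measurable.
apply: (measurability _ (RGenOpens.measurableE R)) => //.
by move=> _ [_ [a [b ->]] <-]; rewrite setTI; apply: fo; exact: interval_open.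
Qed.

Definition ring_isomorphic (A B : nzRingType) : Prop :=
  exists f : {rmorphism A -> B}, bijective f.

(* Main.v *)
Require Import Defs.
From HB Require Import structures.
From mathcomp Require Import all_boot all_order all_algebra.
From mathcomp Require Import all_classical all_reals all_analysis measurable_realfun.

(** Identify two points of X when the same measurable sets contain them, and
    give the quotient Y the sigma-algebra of the sets whose preimage in X is
    measurable.  A measurable set is a union of classes ([measurable_saturated]),
    so preimage by the projection is an isomorphism of lattices from the
    measurable sets of Y to those of X, with inverse the image ([indist_piK],
    [image_pi_preimage]).  Compactness depends only on this lattice, hence passes
    to Y ([indist_quotient_compact]); and two distinct points of Y are separated
    by the image of a measurable set of X that separates their representatives
    ([indist_quotient_T_measurable]).

    A real measurable function f is constant on classes: the measurable set
    of the points where f takes the value f x contains x, hence all of its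
    class ([measurable_fun_indist]).  So f factors uniquely through Y; the factor,
    f composed with any choice of representatives, is measurable
    ([measurable_fun_repr]), and factoring is a ring isomorphism because the
    operations are pointwise ([indist_quotient_mfun]). *)

Set Implicit Arguments.
Unset Strict Implicit.
Unset Printing Implicit Defensive.
Import GRing.Theory.
Local Open Scope classical_set_scope.
Local Open Scope quotient_scope.

Section Indistinguishability.
Context d (X : measurableType d).

Definition indist (x y : X) : bool :=
  `[< forall A : set X, measurable A -> (A x <-> A y) >].

Lemma indist_refl : reflexive indist.
Proof. by move=> x; apply/asboolP. Qed.

Lemma indist_sym : symmetric indist.
Proof.
move=> x y; apply/idP/idP => /asboolP xy; apply/asboolP => A mA;
  by rewrite (xy A mA).
Qed.

Lemma indist_trans : transitive indist.
Proof.
move=> y x z /asboolP xy /asboolP yz; apply/asboolP => A mA.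
by rewrite (xy A mA); exact: yz.
Qed.

Definition indist_equiv := EquivRel indist indist_refl indist_sym indist_trans.

Lemma measurable_saturated (A : set X) x y :
  measurable A -> indist x y -> A x -> A y.
Proof. by move=> mA /asboolP /(_ A mA) []. Qed.

Lemma measurable_fun_indist (R : realType) (f : X -> R) x y :
  measurable_fun setT f -> indist x y -> f x = f y.
Proof.
move=> mf xy; have mfx : measurable (f @^-1` [set f x]).
  rewrite -[_ @^-1` _]setTI; apply: mf => //; exact: measurable_set1.
by have /(_ erefl) -> := measurable_saturated mfx xy.
Qed.

End Indistinguishability.

Definition indist_quotient d (X : measurableType d) : Type :=
  {eq_quot (indist_equiv X)}.

Section QuotientSpace.
Context d (X : measurableType d).
Let Y := indist_quotient X.

HB.instance Definition _ := Choice.on Y.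
HB.instance Definition _ := isPointed.Build Y
  (\pi_{eq_quot (indist_equiv X)} point).

Definition indist_pi (x : X) : Y := \pi_{eq_quot (indist_equiv X)} x.
Definition indist_repr (y : Y) : X := repr (y : {eq_quot (indist_equiv X)}).

Lemma indist_reprK : cancel indist_repr indist_pi.
Proof. by move=> y; exact: reprK. Qed.

Lemma indist_pi_eqP x y : indist_pi x = indist_pi y <-> indist x y.
Proof. by split=> [/eqmodP|xy]; last exact/eqmodP. Qed.

Lemma indist_repr_pi x : indist x (indist_repr (indist_pi x)).
Proof. by apply/indist_pi_eqP; rewrite indist_reprK. Qed.

Definition quotient_measurable : set (set Y) :=
  [set B | measurable (indist_pi @^-1` B)].

Let quotient_measurable0 : quotient_measurable set0.
Proof. by rewrite /quotient_measurable /= preimage_set0. Qed.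

Let quotient_measurableC B : quotient_measurable B -> quotient_measurable (~` B).
Proof.
move=> mB; rewrite /quotient_measurable /= preimage_setC.
exact: measurableC.
Qed.

Let quotient_measurable_bigcup (F : (set Y)^nat) :
  (forall i, quotient_measurable (F i)) -> quotient_measurable (\bigcup_i F i).
Proof.
move=> mF; rewrite /quotient_measurable /= preimage_bigcup.
by apply: bigcup_measurable => k _; exact: mF.
Qed.

HB.instance Definition _ := isMeasurable.Build d Y
  quotient_measurable0 quotient_measurableC quotient_measurable_bigcup.

End QuotientSpace.

Section QuotientTheory.
Context d (X : measurableType d).
Let Y : measurableType d := indist_quotient X.
Let pi : X -> Y := @indist_pi d X.

Lemma indist_piK (A : set X) : measurable A -> pi @^-1` (pi @` A) = A.
Proof.
move=> mA; apply/seteqP; split=> [x [a Aa /indist_pi_eqP ax]|x Ax].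
  exact: measurable_saturated mA ax Aa.
by exists x.
Qed.

Lemma measurable_image_pi (A : set X) : measurable A -> measurable (pi @` A).
Proof.
by move=> mA; rewrite /measurable /= /quotient_measurable /= indist_piK.
Qed.

Lemma image_pi_preimage (B : set Y) : pi @` (pi @^-1` B) = B.
Proof.
apply: image_preimage; rewrite -subTset => y _.
by exists (indist_repr y) => //; exact: indist_reprK.
Qed.

(** Joins are taken among measurable sets only, so an upper bound V upstairs must
    be brought down to Y: its image is a measurable upper bound of S, and V is
    recovered from it because it is saturated. *)
Lemma is_join_preimage (S : set (set Y)) :
  is_join S setT -> is_join (preimage pi @` S) setT.
Proof.
move=> [_ _ Sleast]; split=> // V mV SV x _.
have : (pi @` V) (pi x).
  apply: Sleast => //; first exact: measurable_image_pi.
  move=> B SB; rewrite -(image_pi_preimage B); apply: image_subset.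
  by apply: SV; exists B.
by rewrite -[_ (pi x)]/((pi @^-1` (pi @` V)) x) indist_piK.
Qed.

Lemma is_join_image (T : set (set X)) :
  is_join T setT -> is_join (image^~ pi @` T) setT.
Proof.
move=> [_ _ Tleast]; split=> // V mV TV y _.
have /(_ (indist_repr y) I) : setT `<=` pi @^-1` V.
  by apply: Tleast => // A TA; rewrite -image_sub; apply: TV; exists A.
by rewrite /= /pi indist_reprK.
Qed.

Lemma indist_quotient_compact :
  compact_measurable_space X -> compact_measurable_space Y.
Proof.
move=> cX S mS jS.
have [|T [TS finT jT]] := cX (preimage pi @` S) _ (is_join_preimage jS).
  by move=> _ [B SB <-]; exact: (mS B SB).
exists (image^~ pi @` T); split; last exact: is_join_image.
  by move=> _ [_ /TS [B SB <-] <-]; rewrite image_pi_preimage.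
exact: finite_image.
Qed.

Lemma image_pi_repr (A : set X) y :
  measurable A -> (pi @` A) y <-> A (indist_repr y).
Proof. by move=> mA; rewrite -{2}(indist_piK mA) /= /pi indist_reprK. Qed.

Lemma indist_quotient_T_measurable : T_measurable_space Y.
Proof.
move=> y z yz; apply: contrapT => nsep; apply: yz.
rewrite -(indist_reprK y) -(indist_reprK z).
apply/indist_pi_eqP/asboolP => A mA.
have piA u := image_pi_repr u mA.
split=> Au; apply: contrapT => nA; apply: nsep; exists (pi @` A).
  by split; [exact: measurable_image_pi|left; rewrite !piA].
by split; [exact: measurable_image_pi|right; rewrite !piA].
Qed.

Context (R : realType).

Lemma measurable_fun_pi : measurable_fun setT pi.
Proof. by move=> _ B mB; rewrite setTI. Qed.

(** However representatives are chosen, a measurable set that contains one point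
    of a class contains them all, so its preimage is its image in Y. *)
Lemma measurable_fun_repr : measurable_fun setT (@indist_repr d X : Y -> X).
Proof.
move=> _ A mA; rewrite setTI (_ : _ @^-1` A = pi @` A).
  exact: measurable_image_pi.
by apply/esym/seteqP; split=> y /(image_pi_repr y mA).
Qed.

Lemma mfun_repr_pi (f : {mfun X >-> R}) x : f (indist_repr (pi x)) = f x.
Proof.
apply/esym/measurable_fun_indist; last exact: indist_repr_pi.
exact: measurable_funPT.
Qed.

Definition mfun_factor (f : {mfun X >-> R}) : {mfun Y >-> R} :=
  mfun_Sub (mem_set (measurableT_comp (measurable_funPT f) measurable_fun_repr)).

Definition mfun_pullback (g : {mfun Y >-> R}) : {mfun X >-> R} :=
  mfun_Sub (mem_set (measurableT_comp (measurable_funPT g) measurable_fun_pi)).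

Lemma mfun_factorK : cancel mfun_factor mfun_pullback.
Proof. by move=> f; apply/mfuneqP => x; exact: mfun_repr_pi. Qed.

Lemma mfun_pullbackK : cancel mfun_pullback mfun_factor.
Proof. by move=> g; apply/mfuneqP => y /=; rewrite /pi indist_reprK. Qed.

Let mfun_factor_is_zmod_morphism : zmod_morphism mfun_factor.
Proof. by move=> f g; apply/mfuneqP. Qed.

Let mfun_factor_is_monoid_morphism : monoid_morphism mfun_factor.
Proof. by split=> [|f g]; apply/mfuneqP. Qed.

HB.instance Definition _ := GRing.isZmodMorphism.Build _ _ mfun_factor
  mfun_factor_is_zmod_morphism.
HB.instance Definition _ := GRing.isMonoidMorphism.Build _ _ mfun_factor
  mfun_factor_is_monoid_morphism.

Lemma indist_quotient_mfun : ring_isomorphic {mfun X >-> R} {mfun Y >-> R}.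
Proof.
exists mfun_factor.
by exists mfun_pullback; [exact: mfun_factorK|exact: mfun_pullbackK].
Qed.

End QuotientTheory.

Theorem corollary3 (R : realType) (d : measure_display) (X : measurableType d)
    (hX : compact_measurable_space X) :
  exists (d' : measure_display) (Y : measurableType d'),
    compact_measurable_space Y /\ T_measurable_space Y /\
    ring_isomorphic {mfun X >-> R} {mfun Y >-> R}.
Proof.
exists d, (indist_quotient X); split; first exact: indist_quotient_compact.
by split; [exact: indist_quotient_T_measurable|exact: indist_quotient_mfun].
Qed.
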